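(* Let $(u_h^n,p_h^n,\phi_h^n,\varphi_h^n)\in \mathcal{V}_0^h\times\mathcal{V}_0^h\times V_0^h\times V_0^h$, $n=0,1,\dots,N$, satisfy the fully discrete scheme: for every $n=1,\dots,N$, $$(\overline{p_h^n},v_{1h})=(\partial_t u_h^n,v_{1h})\quad\forall v_{1h}\in\mathcal{V}_0^h,$$ $$(\partial_t p_h^n,v_{2h})+(\nabla\overline{u_h^n},\nabla v_{2h})+(\overline{u_h^n},v_{2h})+(\overline{\varphi_h^n}\,\overline{u_h^n},v_{2h})+\Big(\tfrac12(|u_h^n|^2+|u_h^{n-1}|^2)\overline{u_h^n},v_{2h}\Big)=0\quad\forall v_{2h}\in\mathcal{V}_0^h,$$ $$(\nabla\overline{\phi_h^n},\nabla w_{1h})=-(\partial_t\varphi_h^n,w_{1h})\quad\forall w_{1h}\in V_0^h,$$ $$(\partial_t\phi_h^n,w_{2h})-(\overline{\varphi_h^n},w_{2h})-\Big(\tfrac12(|u_h^n|^2+|u_h^{n-1}|^2),w_{2h}\Big)=0\quad\forall w_{2h}\in V_0^h.$$ Define the discrete energy $$E^n=\|\nabla u_h^n\|_0^2+\|u_h^n\|_0^2+\|p_h^n\|_0^2+\tfrac12\|\varphi_h^n\|_0^2+\tfrac12\|\nabla\phi_h^n\|_0^2+\tfrac12\|u_h^n\|_{0,4}^4+(\varphi_h^n,|u_h^n|^2),\qquad n=0,\dots,N.$$ Then the discrete energy is exactly conserved: $$E^N=E^{N-1}=\cdots=E^0.$$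
   Context: $\Omega\subset\mathbb{R}^d$ ($d=2,3$) is a bounded convex domain partitioned by a uniform mesh $\mathcal{T}_h=\{K\}$ of rectangles ($d=2$) or cuboids ($d=3$) with mesh size $h$. The real finite element space is $V_0^h=\{v_h\in C(\overline\Omega): v_h|_K\in\mathcal{Q}_1(K)\ \forall K\in\mathcal{T}_h,\ v_h|_{\partial\Omega}=0\}$, where $\mathcal{Q}_1(K)=\mathrm{span}\{1,x,y,xy\}$ for $d=2$ and $\mathcal{Q}_1(K)=\mathrm{span}\{1,x,y,z,xy,yz,zx,xyz\}$ for $d=3$ (real coefficients). The complex space is $\mathcal{V}_0^h=\{\xi_1+i\xi_2:\xi_1,\xi_2\in V_0^h\}$. Thus $u_h^n,p_h^n$ are complex-valued and $\phi_h^n,\varphi_h^n$ are real-valued. $(\gamma,\omega)=\int_\Omega\gamma\,\hat\omega\,d\mathbf{x}$, where $\hat\omega$ is the complex conjugate of $\omega$; $\|\cdot\|_0$ is the $L^2(\Omega)$ norm and $\|\cdot\|_{0,4}$ the $L^4(\Omega)$ norm. Time is discretized uniformly: $T>0$, $\tau=T/N$, $t_n=n\tau$. For a sequence $\{\varrho^n\}$, $\partial_t\varrho^n=(\varrho^n-\varrho^{n-1})/\tau$ and $\overline{\varrho^n}=(\varrho^n+\varrho^{n-1})/2$ (the overline denotes this time average, not complex conjugation). *)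

(* Defs.v *)
From HB Require Import structures.
From mathcomp Require Import all_boot all_order all_algebra.
From mathcomp Require Import all_classical all_reals all_analysis.
From mathcomp Require Import complex.

Set Implicit Arguments.
Unset Strict Implicit.
Unset Printing Implicit Defensive.

Import Order.TTheory GRing.Theory Num.Theory.
Import numFieldNormedType.Exports.

Local Open Scope classical_set_scope.
Local Open Scope ring_scope.
Local Open Scope complex_scope.

(* R^d is 'rV[R]_d, with the sigma-algebra generated by the coordinates, that
   is, the Borel sets. *)
Section measurable_rV.
Context {R : realType} {d : nat}.

Definition rV_coord (i : 'I_d) (x : 'rV[R]_d) : R := x ord0 i.

Let rV_set0 : g_sigma_preimage rV_coord set0.
Proof. exact: sigma_algebra0. Qed.

Let rV_setC A : g_sigma_preimage rV_coord A -> g_sigma_preimage rV_coord (~` A).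
Proof. exact: sigma_algebraC. Qed.

Let rV_bigcup (F : nat -> set 'rV[R]_d) :
  (forall i, g_sigma_preimage rV_coord (F i)) ->
  g_sigma_preimage rV_coord (\bigcup_i (F i)).
Proof. exact: sigma_algebra_bigcup. Qed.

HB.instance Definition _ := @isMeasurable.Build default_measure_display
  'rV[R]_d (g_sigma_preimage rV_coord) rV_set0 rV_setC rV_bigcup.

Lemma measurable_rV_coord (i : 'I_d) :
  measurable_fun [set: 'rV[R]_d] (rV_coord i).
Proof.
move=> _ Y mY; rewrite setTI; apply: sub_sigma_algebra => /=.
rewrite -bigcup_seq/=; exists i => /=; first by rewrite mem_index_enum.
by exists Y => //; rewrite setTI.
Qed.

Lemma measurable_fun_rV d1 (T1 : measurableType d1) (f : T1 -> 'rV[R]_d) :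
  (forall i, measurable_fun [set: T1] (fun t => f t ord0 i)) ->
  measurable_fun [set: T1] f.
Proof.
move=> mf _ A mA; rewrite setTI.
suff : g_sigma_preimage (fun i => rV_coord i \o f) `<=` measurable.
  by move=> h; apply: h; rewrite g_sigma_preimage_comp; exists A => //; rewrite setTI.
apply: smallest_sub; first exact: sigma_algebra_measurable.
rewrite -bigcup_seq; apply: bigcup_sub => i _ _ [B mB <-].
exact: mf.
Qed.

End measurable_rV.

Section lebesgue_rV.
Context {R : realType}.

Definition rV_cons d (p : measurableTypeR R * 'rV[R]_d) : 'rV[R]_d.+1 :=
  row_mx (p.1%:M : 'M[R]_1) p.2.

Definition rV_uncons d (x : 'rV[R]_d.+1) : measurableTypeR R * 'rV[R]_d :=
  (x ord0 ord0, \row_j x ord0 (lift ord0 j)).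

Lemma rV_consE d (p : measurableTypeR R * 'rV[R]_d) i :
  rV_cons p ord0 i = oapp (p.2 ord0) p.1 (unlift ord0 i).
Proof.
rewrite /rV_cons; case: unliftP => [j ->|->] /=.
  have -> : lift ord0 j = rshift 1 j by apply: val_inj.
  exact: row_mxEr.
have -> : @ord0 d = lshift d (@ord0 0) by apply: val_inj.
by apply: etrans (row_mxEl _ _ _ _) _; rewrite mxE eqxx mulr1n.
Qed.

Lemma rV_consK d : cancel (@rV_cons d) (@rV_uncons d).
Proof.
move=> [t y]; rewrite /rV_uncons; congr (_, _).
  by rewrite rV_consE unlift_none.
by apply/rowP => j; rewrite mxE rV_consE liftK.
Qed.

Lemma measurable_rV_cons d :
  measurable_fun [set: measurableTypeR R * 'rV[R]_d] (@rV_cons d).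
Proof.
apply: measurable_fun_rV => i; under eq_fun do rewrite rV_consE.
case: (unlift ord0 i) => [j|] /=; last exact: measurable_fst.
exact: (measurableT_comp (measurable_rV_coord j) measurable_snd).
Qed.

Lemma measurable_rV_uncons d :
  measurable_fun [set: 'rV[R]_d.+1] (@rV_uncons d).
Proof.
apply/measurable_fun_pair; first exact: measurable_rV_coord.
apply: measurable_fun_rV => i; under eq_fun do rewrite mxE.
exact: measurable_rV_coord.
Qed.

Section step.
Local Open Scope ereal_scope.
Variables (d : nat) (m : {sigma_finite_measure set 'rV[R]_d -> \bar R}).

Definition lebesgue_rV_step : set 'rV[R]_d.+1 -> \bar R :=
  pushforward (lebesgue_measure \x m) (@rV_cons d).

Let step0 : lebesgue_rV_step set0 = 0.
Proof. by rewrite /lebesgue_rV_step /pushforward preimage_set0 measure0. Qed.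

Let step_ge0 A : 0 <= lebesgue_rV_step A.
Proof. by rewrite /lebesgue_rV_step /pushforward; exact: measure_ge0. Qed.

Let step_sigma_additive : semi_sigma_additive lebesgue_rV_step.
Proof.
move=> F mF tF mUF; rewrite /lebesgue_rV_step /pushforward preimage_bigcup.
have mc A : measurable A -> measurable (@rV_cons d @^-1` A).
  by move=> mA; rewrite -[X in measurable X]setTI; exact: measurable_rV_cons.
apply: measure_semi_sigma_additive => [n||].
- exact: mc.
- apply/trivIsetP => /= i j _ _ ij; rewrite -preimage_setI.
  by move/trivIsetP : tF => /(_ _ _ _ _ ij) ->//; rewrite preimage_set0.
- by rewrite -preimage_bigcup; exact: mc.
Qed.

HB.instance Definition _ := isMeasure.Build _ _ _ lebesgue_rV_step
  step0 step_ge0 step_sigma_additive.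

Let prod_sigma_finite : sigma_finite setT (lebesgue_measure \x m).
Proof.
have /sigma_finiteP[F [TF ndF Foo]] := sigma_finiteT (@lebesgue_measure R).
have /sigma_finiteP[G [TG ndG Goo]] := sigma_finiteT m.
exists (fun n => F n `*` G n).
  rewrite -setXTT TF TG predeqE => -[x y]; split.
    move=> [/= [n _ Fnx] [k _ Gky]]; exists (maxn n k) => //; split.
    - by move: x Fnx; exact/subsetPset/ndF/leq_maxl.
    - by move: y Gky; exact/subsetPset/ndG/leq_maxr.
  by move=> [n _ []/= ? ?]; split; exists n.
move=> k; have [? ?] := Foo k; have [? ?] := Goo k.
split; first exact: measurableX.
by rewrite product_measure1E// lte_mul_pinfty// ge0_fin_numE.
Qed.

Let step_sigma_finite : sigma_finite setT lebesgue_rV_step.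
Proof.
have [F TF F_fin] := prod_sigma_finite.
exists (fun n => @rV_uncons d @^-1` F n).
  by rewrite -preimage_bigcup -TF preimage_setT.
move=> n; have [mF Foo] := F_fin n; split.
  by rewrite -[X in measurable X]setTI; exact: measurable_rV_uncons.
rewrite /lebesgue_rV_step /pushforward -comp_preimage.
by rewrite (_ : _ \o _ = id) ?preimage_id//; apply/funext => p; exact: rV_consK.
Qed.

HB.instance Definition _ := Measure_isSigmaFinite.Build _ _ _ lebesgue_rV_step
  step_sigma_finite.

End step.

Fixpoint lebesgue_rV d : {sigma_finite_measure set 'rV[R]_d -> \bar R} :=
  if d is d'.+1 then lebesgue_rV_step (lebesgue_rV d')
  else \d_(0 : 'rV[R]_0).

Lemma lebesgue_rV_box d (a b : 'rV[R]_d) :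
  (forall i, a ord0 i <= b ord0 i) ->
  lebesgue_rV d [set x | forall i, a ord0 i <= x ord0 i <= b ord0 i]
  = (\prod_i (b ord0 i - a ord0 i))%:E.
Proof.
elim: d a b => [|d IH] a b ab.
  rewrite big_ord0 /= diracE (_ : _ \in _) //.
  by rewrite inE /= => -[].
rewrite big_ord_recl EFinM.
pose a' : 'rV[R]_d := \row_j a ord0 (lift ord0 j).
pose b' : 'rV[R]_d := \row_j b ord0 (lift ord0 j).
have -> : (\prod_(i < d) (b ord0 (lift ord0 i) - a ord0 (lift ord0 i)))%:E
    = lebesgue_rV d [set x | forall i, a' ord0 i <= x ord0 i <= b' ord0 i].
  rewrite IH; last by move=> i; rewrite !mxE.
  by congr EFin; apply: eq_bigr => i _; rewrite !mxE.
rewrite -[LHS]/((lebesgue_measure \x lebesgue_rV d)%E (@rV_cons d @^-1` _)).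
rewrite (_ : @rV_cons d @^-1` _ =
    (`[a ord0 ord0, b ord0 ord0]%classic : set (measurableTypeR R))
    `*` [set x : 'rV[R]_d | forall i, a' ord0 i <= x ord0 i <= b' ord0 i]).
  rewrite product_measure1E//=.
  - rewrite lebesgue_measure_itv/= lte_fin.
    have := ab ord0; rewrite le_eqVlt => /predU1P[->|->]; last by rewrite -EFinB.
    by rewrite ltxx subrr.
  - rewrite (_ : mkset _ = \bigcap_(i in [set: 'I_d])
        (rV_coord i @^-1` `[a' ord0 i, b' ord0 i]%classic)).
      apply: fin_bigcap_measurable => // i _.
      by rewrite -[X in measurable X]setTI; exact: measurable_rV_coord.
    apply/seteqP; split=> x /= h i; first by move=> _; rewrite /= in_itv/=; exact: h.
    by have := h i I; rewrite /= in_itv.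
apply/seteqP; split=> -[t y] /= h.
  split; first by have := h ord0; rewrite rV_consE unlift_none in_itv.
  by move=> i; have := h (lift ord0 i); rewrite rV_consE liftK !mxE.
move=> i; rewrite rV_consE; case: unliftP => [j ->|->] /=.
  by have := h.2 j; rewrite !mxE.
by have := h.1; rewrite in_itv.
Qed.

End lebesgue_rV.

(* A uniform axis-parallel mesh: a finite set of cells of the lattice
   mesh_origin + (mesh_step_1 Z) x ... x (mesh_step_d Z). *)
Record uniform_mesh (R : realType) (d : nat) := UniformMesh {
  mesh_origin : 'rV[R]_d;
  mesh_step : 'rV[R]_d;
  mesh_step_gt0 : forall i, 0 < mesh_step ord0 i;
  mesh_index : seq 'rV[int]_d
}.

Section finite_elements.
Context {R : realType} {d : nat}.
Implicit Types (Omega : set 'rV[R]_d) (Th : uniform_mesh R d).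

Definition cell Th (k : 'rV[int]_d) : set 'rV[R]_d :=
  [set x | forall i,
     mesh_origin Th ord0 i + (k ord0 i)%:~R * mesh_step Th ord0 i
       <= x ord0 i
       <= mesh_origin Th ord0 i + (k ord0 i + 1)%:~R * mesh_step Th ord0 i].

(* Distinct lattice cells have disjoint interiors, so only the covering has to
   be required. *)
Definition mesh_of Omega Th : Prop :=
  closure Omega = \bigcup_(k in [set` mesh_index Th]) cell Th k.

Definition boundary Omega : set 'rV[R]_d := closure Omega `\` Omega°.

(* Q_1 is spanned by the monomials x_S = \prod_(i in S) x_i for S a subset of
   the coordinates: 1, x, y, xy if d = 2 and 1, x, ..., xyz if d = 3. *)
Definition Q1_on (K : set 'rV[R]_d) (v : 'rV[R]_d -> R) : Prop :=
  exists c : {set 'I_d} -> R,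
    forall x, K x -> v x = \sum_(S : {set 'I_d}) c S * \prod_(i in S) x ord0 i.

(* Functions on the closure of Omega are represented by total functions whose
   values elsewhere are irrelevant. *)
Definition V0 Omega Th : set ('rV[R]_d -> R) :=
  [set v | [/\ {within closure Omega, continuous v},
     forall k, k \in mesh_index Th -> Q1_on (cell Th k) v &
     forall x, boundary Omega x -> v x = 0]].

Definition V0C Omega Th : set ('rV[R]_d -> R[i]) :=
  [set v | exists xi1 xi2, [/\ V0 Omega Th xi1, V0 Omega Th xi2 &
     v = fun x => xi1 x +i* xi2 x]].

(* The partial derivatives of finite element functions are the classical ones
   in the interior of each cell. On the union of the faces, a null set, a
   derivative need not exist and its value is set to 0. *)
Definition partial Th (v : 'rV[R]_d -> R) (i : 'I_d) : 'rV[R]_d -> R :=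
  patch (cst 0) (\bigcup_(k in [set` mesh_index Th]) (cell Th k)°)
    ('D_(delta_mx ord0 i) v).

Definition partialC Th (v : 'rV[R]_d -> R[i]) (i : 'I_d) (x : 'rV[R]_d) : R[i] :=
  partial Th (fun y => complex.Re (v y)) i x +i* partial Th (fun y => complex.Im (v y)) i x.

Definition ip Omega (f g : 'rV[R]_d -> R) : R :=
  \int[lebesgue_rV d]_(x in Omega) (f x * g x).

Definition integralC Omega (f : 'rV[R]_d -> R[i]) : R[i] :=
  (\int[lebesgue_rV d]_(x in Omega) complex.Re (f x))
    +i* (\int[lebesgue_rV d]_(x in Omega) complex.Im (f x)).

Definition ipC Omega (f g : 'rV[R]_d -> R[i]) : R[i] :=
  integralC Omega (fun x => f x * (g x)^*).

Definition ip_grad Omega Th (f g : 'rV[R]_d -> R) : R :=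
  \int[lebesgue_rV d]_(x in Omega) \sum_i partial Th f i x * partial Th g i x.

Definition ipC_grad Omega Th (f g : 'rV[R]_d -> R[i]) : R[i] :=
  integralC Omega
    (fun x => \sum_i partialC Th f i x * (partialC Th g i x)^*).

Definition modulus (z : R[i]) : R := ComplexField.Normc.normc z.

(* The L^p(Omega) norm of a function or vector field, given its pointwise
   length. *)
Definition Lp_norm Omega (p : R) (g : 'rV[R]_d -> R) : R :=
  fine ('N[lebesgue_rV d]_(p%:E) [EFin \o patch (cst 0%R) Omega g])%E.

Definition normL Omega (p : R) (v : 'rV[R]_d -> R) : R :=
  Lp_norm Omega p (fun x => `|v x|).

Definition normLC Omega (p : R) (v : 'rV[R]_d -> R[i]) : R :=
  Lp_norm Omega p (fun x => modulus (v x)).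

Definition normL_grad Omega Th (p : R) (v : 'rV[R]_d -> R) : R :=
  Lp_norm Omega p (fun x => Num.sqrt (\sum_i partial Th v i x ^+ 2)).

Definition normLC_grad Omega Th (p : R) (v : 'rV[R]_d -> R[i]) : R :=
  Lp_norm Omega p
    (fun x => Num.sqrt (\sum_i modulus (partialC Th v i x) ^+ 2)).

Definition energy Omega Th (u p : 'rV[R]_d -> R[i]) (phi vphi : 'rV[R]_d -> R)
    : R :=
  normLC_grad Omega Th 2 u ^+ 2 + normLC Omega 2 u ^+ 2 + normLC Omega 2 p ^+ 2
  + 2^-1 * normL Omega 2 vphi ^+ 2 + 2^-1 * normL_grad Omega Th 2 phi ^+ 2
  + 2^-1 * normLC Omega 4 u ^+ 4 + ip Omega vphi (fun x => modulus (u x) ^+ 2).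

End finite_elements.

(* For n >= 1; tau is the time step. *)
Definition bdiff (X : Type) (K : fieldType) (tau : K) (r : nat -> X -> K)
    (n : nat) : X -> K :=
  fun x => (r n x - r n.-1 x) / tau.

Definition tavg (X : Type) (K : fieldType) (r : nat -> X -> K) (n : nat)
    : X -> K :=
  fun x => (r n x + r n.-1 x) / 2%:R.

(* Main.v *)
Require Import Defs.
From mathcomp Require Import all_boot all_order all_algebra.
From mathcomp Require Import all_classical all_reals all_analysis.
From mathcomp Require Import complex.
From mathcomp Require Import measurable_realfun ring lra.
Import Order.TTheory GRing.Theory Num.Theory.
Import numFieldNormedType.Exports.
Local Open Scope classical_set_scope.
Local Open Scope ring_scope.
Local Open Scope complex_scope.

(** Why the discrete energy is conserved. The midpoint average and the backward
    difference quotient obey the Leibniz rule exactly ([tavg_bdiffM]):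
    avg f * diff g + diff f * avg g = diff (f g). In particular
    avg f * diff f = diff (f^2) / 2, and for complex u the real part of
    avg u * conj (diff u) is diff (|u|^2) / 2 ([Re_tavg_bdiff]).

    Test the four equations with diff p, diff u, diff phi and diff vphi and take
    real parts of the first two. The first two give
    diff (|p|^2 + |grad u|^2 + |u|^2 + |u|^4 / 2) + avg vphi * diff (|u|^2) = 0
    in integrated form, because Re (diff p, diff u) is symmetric. The last two
    give diff (|vphi|^2 + |grad phi|^2) / 2 + avg (|u|^2) * diff vphi = 0, because
    (diff vphi, diff phi) is symmetric. By the Leibniz rule the two coupling
    terms add up to diff (vphi |u|^2), so that the sum of the two identities is
    diff E = 0 ([energy_step]).

    The rest of the argument makes the integrals legitimate. Integrals are
    additive only on integrable functions, and partial derivatives only where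
    they exist. A finite element function is a polynomial on each of finitely
    many bounded cells, hence bounded and measurable on Omega, and so are its
    partial derivatives ([bdmeas_V0], [bdmeas_partial]); Omega is open, hence
    measurable ([open_measurable_rV]), and has finite measure ([domain_lty]). The
    differences of finite element functions are again finite element functions,
    thus admissible as test functions ([V0_lincomb]). *)

Set Implicit Arguments.
Unset Strict Implicit.
Unset Printing Implicit Defensive.

(** * Bounded measurable functions *)

Section bounded_measurable.
Context {disp : measure_display} {T : measurableType disp} {R : realType}.
Implicit Types (D : set T) (f g : T -> R).

(** Products of integrable functions need not be integrable, whereas bounded
    measurable functions form an algebra. On a set of finite measure they are
    integrable, which is how every integral below is shown to be finite. *)
Definition bdmeas D f :=
  measurable_fun D f /\ exists M, forall x, D x -> `|f x| <= M.

Lemma bdmeas_cst D (c : R) : bdmeas D (fun=> c).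
Proof. by split; [exact: measurable_cst | exists `|c|]. Qed.

Lemma bdmeasD D f g : bdmeas D f -> bdmeas D g ->
  bdmeas D (fun x => f x + g x).
Proof.
move=> [mf [M fM]] [mg [P gP]]; split; first exact: measurable_funD.
exists (M + P) => x Dx.
by rewrite (le_trans (ler_normD _ _))// lerD ?fM ?gP.
Qed.

Lemma bdmeasM D f g : bdmeas D f -> bdmeas D g ->
  bdmeas D (fun x => f x * g x).
Proof.
move=> [mf [M fM]] [mg [P gP]]; split; first exact: measurable_funM.
by exists (M * P) => x Dx; rewrite normrM ler_pM ?fM ?gP.
Qed.

Lemma bdmeasB D f g : bdmeas D f -> bdmeas D g ->
  bdmeas D (fun x => f x - g x).
Proof.
move=> mf mg; rewrite (_ : (fun x => _) = fun x => f x + -1 * g x).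
  by apply: bdmeasD => //; apply: bdmeasM => //; exact: bdmeas_cst.
by apply/funext => x; rewrite mulN1r.
Qed.

Lemma bdmeasX D f n : bdmeas D f -> bdmeas D (fun x => f x ^+ n).
Proof.
move=> bf; elim: n => [|n IH]; first exact: bdmeas_cst.
by under eq_fun do rewrite exprS; exact: bdmeasM.
Qed.

Lemma bdmeas_sum (I : Type) (r : seq I) (P : pred I) (h : I -> T -> R) D :
  (forall i, bdmeas D (h i)) -> bdmeas D (fun x => \sum_(i <- r | P i) h i x).
Proof.
move=> bh; elim: r => [|i r IH].
  by under eq_fun do rewrite big_nil; exact: bdmeas_cst.
under eq_fun do rewrite big_cons.
by case: (P i) => //; exact: bdmeasD.
Qed.

Lemma bdmeas_prod (I : Type) (r : seq I) (P : pred I) (h : I -> T -> R) D :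
  (forall i, bdmeas D (h i)) -> bdmeas D (fun x => \prod_(i <- r | P i) h i x).
Proof.
move=> bh; elim: r => [|i r IH].
  by under eq_fun do rewrite big_nil; exact: bdmeas_cst.
under eq_fun do rewrite big_cons.
by case: (P i) => //; exact: bdmeasM.
Qed.

Lemma eq_bdmeas D f g : (forall x, D x -> f x = g x) ->
  bdmeas D f -> bdmeas D g.
Proof.
move=> fg [mf [M fM]]; split; last by exists M => x Dx; rewrite -fg// fM.
by apply: eq_measurable_fun mf => x /set_mem; exact: fg.
Qed.

Lemma sub_bdmeas D E f : measurable E -> D `<=` E -> bdmeas E f -> bdmeas D f.
Proof.
move=> mE DE [mf [M fM]]; split; first exact: measurable_funS mf.
by exists M => x /DE; exact: fM.
Qed.

Lemma bdmeasU D E f : measurable D -> measurable E ->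
  bdmeas D f -> bdmeas E f -> bdmeas (D `|` E) f.
Proof.
move=> mD mE [mDf [M fM]] [mEf [P fP]]; split; first exact/measurable_funU.
exists (Num.max M P) => x [/fM|/fP] fx; by rewrite le_max fx ?orbT.
Qed.

Lemma bdmeas_bigcup (I : choiceType) (s : seq I) (D : I -> set T) f :
  (forall k, measurable (D k)) -> (forall k, k \in s -> bdmeas (D k) f) ->
  bdmeas (\bigcup_(k in [set` s]) D k) f.
Proof.
move=> mD; rewrite bigcup_seq; elim: s => [|k s IH] bD.
  by rewrite big_nil; split; [exact: measurable_fun_set0 | exists 0].
rewrite big_cons; apply: bdmeasU => //; first exact: bigsetU_measurable.
  by apply: bD; rewrite mem_head.
by apply: IH => j js; apply: bD; rewrite inE js orbT.
Qed.

Lemma bdmeas_integrable (mu : {measure set T -> \bar R}) D f :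
  measurable D -> (mu D < +oo)%E -> bdmeas D f -> mu.-integrable D (EFin \o f).
Proof.
move=> mD Dfin [mf [M fM]]; apply: measurable_bounded_integrable => //.
exists M; split; first exact: num_real.
by move=> y My x Dx /=; rewrite (le_trans (fM x Dx))// ltW.
Qed.

End bounded_measurable.

(** * Borel sets, derivatives and norms in R^d *)

Section euclidean.
Context {R : realType} {d : nat}.

(** The topology of the sup norm has a countable base of boxes with rational
    center and radius, and a box is a finite intersection of preimages of
    intervals under the coordinates. *)
Lemma open_measurable_rV (A : set 'rV[R]_d) : open A -> measurable A.
Proof.
move=> oA.
pose box (z : 'rV[rat]_d * rat) : set 'rV[R]_d :=
  \bigcap_(i in [set: 'I_d])
    rV_coord i @^-1` (ball (ratr (z.1 ord0 i) : R) (ratr z.2)).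
have mbox z : measurable (box z).
  apply: fin_bigcap_measurable => // i _; rewrite -[X in measurable X]setTI.
  by apply: measurable_rV_coord => //; exact: measurable_ball.
rewrite (_ : A = \bigcup_z (if `[<box z `<=` A>] then box z else set0)).
  apply: countable_bigcupT_measurable => [|z]; first exact: countableP.
  by case: ifP.
apply/seteqP; split=> [x Ax|x [z _]]; last first.
  by case: asboolP => // zA /zA.
have [e /= e0 xeA] := (nbhs_ballP _ _).1 (open_nbhs_nbhs (conj oA Ax)).
(* The ball of radius r around a point at distance less than r from x has
   to stay within distance 2 r < e of x. *)
have [r] : exists r : rat, (ratr r : R) \in `]0, (e / 2)[.
  by apply: rat_in_itvoo; rewrite divr_gt0.
rewrite in_itv /= => /andP[r0 re].
have /choice[q xq] : forall i : 'I_d,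
    exists q : rat, ball (ratr q : R) (ratr r) (x ord0 i).
  move=> i; have [q] : exists q : rat,
      (ratr q : R) \in `](x ord0 i - ratr r), (x ord0 i + ratr r)[.
    by apply: rat_in_itvoo; lra.
  rewrite in_itv /= => /andP[q1 q2]; exists q.
  by rewrite /ball/= ltr_distlC; apply/andP; split; lra.
exists (\row_i q i, r) => //.
case: asboolP => [_ i _|]; first by rewrite /= mxE; exact: xq.
case; apply: subset_trans xeA => y qy; split => // i j; rewrite ord1 {i}.
have := qy j I; have := xq j; rewrite /box /= mxE /rV_coord /ball /= => h1 h2.
rewrite -(subrKA (ratr (q j) : R)) (le_lt_trans (ler_normD _ _))//.
rewrite distrC; lra.
Qed.

(** The difference quotient is then constant near 0, so there is no limit to
    compute. *)
Lemma is_derive_near_affine (f : 'rV[R]_d -> R) (x v : 'rV[R]_d) (a : R) :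
  (\forall h \near 0, f (h *: v + x) = f x + h * a) -> is_derive x v f a.
Proof.
move=> fa.
have fa' : (fun h : R => h^-1 *: ((f \o shift x) (h *: v) - f x)) @ 0^' --> a.
  apply: cvg_near_cst.
  near=> h.
  have h0 : h != 0 by near: h; exact: nbhs_dnbhs_neq.
  rewrite /= (_ : f (h *: v + x) = f x + h * a); last by near: h; exact: nbhs_dnbhs.
  by rewrite addrC addKr /GRing.scale /= mulKf.
by apply: DeriveDef; [apply/cvg_ex; exists a | exact: cvg_lim].
Unshelve. all: by end_near. Qed.

(** The two sides also agree for functions outside L^k: an infinite integral
    makes the norm infinite, and [fine] sends both to 0. *)
Lemma Lp_norm_exp (Omega : set 'rV[R]_d) (k : nat) (g : 'rV[R]_d -> R) :
  (0 < k)%N ->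
  Lp_norm Omega k%:R g ^+ k = \int[lebesgue_rV d]_(x in Omega) `|g x| ^+ k.
Proof.
move=> k0; have kn0 : k%:R != 0 :> R by rewrite pnatr_eq0 -lt0n.
rewrite /Lp_norm -powR_mulrn ?fine_ge0 ?Lnorm_ge0// -fine_poweR.
rewrite poweR_Lnorm// Rintegral_mkcond; congr fine.
apply: eq_integral => x _; rewrite /= /patch; case: ifP => _.
  by rewrite powR_mulrn.
by rewrite /= normr0 powR0.
Qed.

End euclidean.

(** * Finite element functions and their derivatives *)

Section mesh.
Context {R : realType} {d : nat}.
Variables (Omega : set 'rV[R]_d) (Th : uniform_mesh R d).
Implicit Types (f g v : 'rV[R]_d -> R) (k : 'rV[int]_d).

Lemma measurable_cell k : measurable (cell Th k).
Proof.
rewrite (_ : cell Th k = \bigcap_(i in [set: 'I_d]) rV_coord i @^-1`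
  `[mesh_origin Th ord0 i + (k ord0 i)%:~R * mesh_step Th ord0 i,
    mesh_origin Th ord0 i + (k ord0 i + 1)%:~R * mesh_step Th ord0 i]%classic).
  apply: fin_bigcap_measurable => // i _; rewrite -[X in measurable X]setTI.
  exact: measurable_rV_coord.
apply/seteqP; split=> x xk i => [_|]; first by rewrite /= in_itv /=; exact: xk.
by have := xk i I; rewrite /= in_itv.
Qed.

Lemma measurable_interior_cell k : measurable (cell Th k)°.
Proof. apply: open_measurable_rV; exact: open_interior. Qed.

Lemma cell_lty k : (lebesgue_rV d (cell Th k) < +oo)%E.
Proof.
pose a (t : int) : 'rV[R]_d :=
  \row_i (mesh_origin Th ord0 i + (k ord0 i + t)%:~R * mesh_step Th ord0 i).
rewrite (_ : cell Th k =
    [set x | forall i, a 0 ord0 i <= x ord0 i <= a 1 ord0 i]); last first.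
  by apply/seteqP; split=> x xk i; have := xk i; rewrite !mxE addr0.
rewrite lebesgue_rV_box ?ltry// => i.
by rewrite !mxE lerD2l ler_wpM2r ?ler_int ?lerD2l// ltW// mesh_step_gt0.
Qed.

Lemma bdmeas_coord_cell k i : bdmeas (cell Th k) (fun x => x ord0 i).
Proof.
split; first exact: measurable_funTS (measurable_rV_coord i).
exists (`|mesh_origin Th ord0 i + (k ord0 i)%:~R * mesh_step Th ord0 i| +
   `|mesh_origin Th ord0 i + (k ord0 i + 1)%:~R * mesh_step Th ord0 i|).
move=> x /(_ i); set a := _ + _; set b := _ + _ => /andP[ax xb].
have := ler_norm b; have := ler_norm (- a); have := normr_ge0 a.
have := normr_ge0 b; rewrite normrN => *.
by rewrite ler_norml; apply/andP; split; lra.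
Qed.

(** The shape shared by the elements of Q_1 ([h] the identity) and by their
    partial derivatives ([h] removes a coordinate from each monomial). *)
Lemma bdmeas_sum_monomial k (P : pred {set 'I_d}) (c : {set 'I_d} -> R)
    (h : {set 'I_d} -> {set 'I_d}) :
  bdmeas (cell Th k)
    (fun x => \sum_(S | P S) c S * \prod_(i in h S) x ord0 i).
Proof.
apply: bdmeas_sum => S; apply: bdmeasM; first exact: bdmeas_cst.
by apply: bdmeas_prod => i; exact: bdmeas_coord_cell.
Qed.

(** A monomial of Q_1 has degree at most 1 in the coordinate x_i, so along the
    i-th axis the difference quotient of [v] is constant as long as one stays
    in the cell. Hence the derivative is again a polynomial. *)
Lemma is_derive_Q1 k v i : Q1_on (cell Th k) v ->
  exists2 w, bdmeas (cell Th k) w &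
    forall x, (cell Th k)° x -> is_derive x (delta_mx ord0 i) v (w x).
Proof.
move=> [c vc].
exists (fun x : 'rV[R]_d =>
    \sum_(S : {set 'I_d} | i \in S) c S * \prod_(j in S :\ i) x ord0 j).
  exact: (bdmeas_sum_monomial k _ c (fun S => S :\ i)).
move=> x kx; apply: is_derive_near_affine; near=> h.
rewrite !vc; last 2 first.
- exact: interior_subset.
- near: h.
  have cl : (fun h : R => h *: (delta_mx ord0 i : 'rV[R]_d) + x) @ 0 --> x.
    rewrite -[X in _ --> X]add0r -(scale0r (delta_mx ord0 i : 'rV[R]_d)).
    by apply: cvgD; [apply: cvgZr_tmp => //; exact: cvg_id|exact: cvg_cst].
  exact: cl.
rewrite mulr_sumr [X in _ = _ + X]big_mkcond -big_split /=; apply: eq_bigr => S _.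
case: ifPn => iS.
  rewrite !(big_setD1 i iS) /= !mxE !eqxx /=.
  under eq_bigr => j /setD1P[ji _] do
    rewrite !mxE (negbTE ji) andbF mulr0 add0r.
  by ring.
rewrite addr0; congr (_ * _); apply: eq_bigr => j jS.
rewrite !mxE (_ : (j == i) = false) ?andbF ?mulr0 ?add0r//.
by apply: contraNF iS => /eqP <-.
Unshelve. all: by end_near. Qed.

Hypothesis Omega_open : open Omega.
Hypothesis Omega_mesh : mesh_of Omega Th.

Lemma domain_sub_cells :
  Omega `<=` \bigcup_(k in [set` mesh_index Th]) cell Th k.
Proof. by rewrite -Omega_mesh; exact: subset_closure. Qed.

Lemma measurable_cells :
  measurable (\bigcup_(k in [set` mesh_index Th]) cell Th k).
Proof.
by rewrite bigcup_seq; apply: bigsetU_measurable => k _; exact: measurable_cell.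
Qed.

Lemma domain_lty : (lebesgue_rV d Omega < +oo)%E.
Proof.
have mO := open_measurable_rV Omega_open.
apply: (@le_lt_trans _ _ (lebesgue_rV d (\bigcup_(k in [set` mesh_index Th]) cell Th k))).
  rewrite le_measure ?inE//; [exact: measurable_cells | exact: domain_sub_cells].
rewrite bigcup_seq; elim: (mesh_index Th) => [|k s IH].
  by rewrite big_nil measure0.
rewrite big_cons (le_lt_trans (measureU2 _ _ _))//.
- exact: measurable_cell.
- by apply: bigsetU_measurable => *; exact: measurable_cell.
- by rewrite lte_add_pinfty// cell_lty.
Qed.

Lemma bdmeas_V0 v : V0 Omega Th v -> bdmeas Omega v.
Proof.
move=> [_ Q1v _]; apply: sub_bdmeas measurable_cells domain_sub_cells _.
apply: bdmeas_bigcup => [|k /Q1v[c vc]]; first exact: measurable_cell.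
apply: eq_bdmeas (fun x kx => esym (vc x kx)) _.
exact: (bdmeas_sum_monomial k xpredT c id).
Qed.

(** On each open cell the derivative is a polynomial; on the faces and outside
    the mesh it is 0 by definition. *)
Lemma bdmeas_partial v i : V0 Omega Th v -> bdmeas Omega (partial Th v i).
Proof.
move=> [_ Q1v _].
set U := \bigcup_(k in [set` mesh_index Th]) (cell Th k)°.
have mU : measurable U.
  rewrite /U bigcup_seq; apply: bigsetU_measurable => k _.
  exact: measurable_interior_cell.
apply: (@sub_bdmeas _ _ _ _ (U `|` ~` U)); rewrite ?setUv//.
rewrite -(setUv U); apply: bdmeasU => //; first exact: measurableC.
- apply: bdmeas_bigcup => [|k ks]; first exact: measurable_interior_cell.
  have [w bw vw] := is_derive_Q1 i (Q1v _ ks).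
  apply: (@eq_bdmeas _ _ _ _ w); last first.
    by apply: sub_bdmeas bw; [exact: measurable_cell | exact: interior_subset].
  move=> x kx; rewrite /partial patchT ?inE; last by exists k.
  by case: (vw x kx) => _ ->.
- apply: (@eq_bdmeas _ _ _ _ (fun=> 0)); last exact: bdmeas_cst.
  by move=> x Ux; rewrite /partial patchN// notin_setE.
Qed.

(** A derivative defined as a limit is linear only where the limits exist;
    on open cells they do because the functions are polynomials there. *)
Lemma partial_lincomb (a b : R) f g i : V0 Omega Th f -> V0 Omega Th g ->
  partial Th (fun x => a * f x + b * g x) i
  = fun x => a * partial Th f i x + b * partial Th g i x.
Proof.
move=> [_ Qf _] [_ Qg _]; apply/funext => x.
rewrite /partial /patch; case: ifPn => [/set_mem[k ks kx]|_]; last first.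
  by rewrite !mulr0 addr0.
have [w _ /(_ x kx) fw] := is_derive_Q1 i (Qf _ ks).
have [z _ /(_ x kx) gz] := is_derive_Q1 i (Qg _ ks).
have -> : 'D_(delta_mx ord0 i) (fun x => a * f x + b * g x) x = a * w x + b * z x.
  have -> : (fun x => a * f x + b * g x) =
      a \*: (f : 'rV[R]_d -> R^o) + b \*: (g : 'rV[R]_d -> R^o) by [].
  by case: (is_deriveD (is_deriveZ a fw) (is_deriveZ b gz)).
by case: fw gz => _ -> [_ ->].
Qed.

Lemma V0_lincomb (a b : R) f g : V0 Omega Th f -> V0 Omega Th g ->
  V0 Omega Th (fun x => a * f x + b * g x).
Proof.
move=> [cf Qf bf] [cg Qg bg]; split.
- by move=> x; apply: cvgD; apply: cvgMl_tmp; [exact: cf|exact: cg].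
- move=> k ks; have [c fc] := Qf k ks; have [e ge] := Qg k ks.
  exists (fun S => a * c S + b * e S) => x kx; rewrite fc// ge// !mulr_sumr.
  by rewrite -big_split; apply: eq_bigr => S _ /=; ring.
- by move=> x bx; rewrite bf// bg// !mulr0 addr0.
Qed.

End mesh.

(** * Discrete calculus in time *)

Section pointwise.
Context {R : realType} {X : Type}.
Implicit Types (tau : R) (n : nat) (z : nat -> X -> R[i]) (f g : nat -> X -> R).

Lemma modulus_sqr (c : R[i]) :
  modulus c ^+ 2 = complex.Re c ^+ 2 + complex.Im c ^+ 2.
Proof.
by case: c => a b; rewrite /modulus /= sqr_sqrtr// addr_ge0// sqr_ge0.
Qed.

Lemma ReD (c e : R[i]) : complex.Re (c + e) = complex.Re c + complex.Re e.
Proof. by case: c e => a b []. Qed.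

Lemma ReMc (r : R) (c : R[i]) : complex.Re (r%:C * c) = r * complex.Re c.
Proof. by case: c => a b /=; rewrite mul0r subr0. Qed.

Lemma Re_MconjC (c e : R[i]) : complex.Re (c * e^*) =
  complex.Re c * complex.Re e + complex.Im c * complex.Im e.
Proof. by case: c e => a b [a' b'] /=; rewrite mulrN opprK. Qed.

Lemma divc_real (c : R[i]) (r : R) :
  c / r%:C = (complex.Re c / r) +i* (complex.Im c / r).
Proof.
by rewrite -fmorphV; case: c => a b /=; apply/eqP; rewrite eq_complex /=
  !mulr0 subr0 add0r !eqxx.
Qed.

Lemma tavgC z n x : tavg z n x =
  tavg (fun k y => complex.Re (z k y)) n x
  +i* tavg (fun k y => complex.Im (z k y)) n x.
Proof.
rewrite /tavg -[2%:R in LHS](rmorph_nat (real_complex R)) divc_real.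
by case: (z n x) (z n.-1 x) => a b [a' b'].
Qed.

Lemma bdiffC tau z n x : bdiff tau%:C z n x =
  bdiff tau (fun k y => complex.Re (z k y)) n x
  +i* bdiff tau (fun k y => complex.Im (z k y)) n x.
Proof.
by rewrite /bdiff divc_real; case: (z n x) (z n.-1 x) => a b [a' b'].
Qed.

(** Discrete Leibniz rule: the midpoint average and the difference quotient
    satisfy the product rule without remainder. This is what makes the scheme
    conserve the energy exactly. *)
Lemma tavg_bdiffM tau f g n x :
  tavg f n x * bdiff tau g n x + bdiff tau f n x * tavg g n x
  = bdiff tau (fun k y => f k y * g k y) n x.
Proof.
by rewrite /tavg /bdiff; set t := tau^-1; field.
Qed.

(** Taking the real part symmetrizes avg u * conj (diff u), which turns it into
    half of the Leibniz rule for the product of u and conj u. *)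
Lemma Re_tavg_bdiff tau z n x :
  complex.Re (tavg z n x * (bdiff tau%:C z n x)^*)
  = 2^-1 * bdiff tau (fun k y => modulus (z k y) ^+ 2) n x.
Proof.
rewrite Re_MconjC tavgC bdiffC /= /bdiff /tavg !modulus_sqr.
by set t := tau^-1; field.
Qed.

End pointwise.

(** * Energy balance of one time step *)

(** The elimination behind [energy_step], over arbitrary numbers: [pu] stands
    for the integral of the product of the difference quotients of p and u, [gu]
    for that of the average of grad u and the difference quotient of grad u,
    and so on; q is |u|^2, and [c] is the integral of avg vphi * diff q. Doubled,
    the first equation says that P, G, Q and W / 2 change by - c [tau] in total;
    the equations for [gphi] and [pv] say that F / 2 and V / 2 change by
    - vq [tau]; and C changes by (c + vq) [tau]. *)
Lemma combine_tested_equations (K : realFieldType)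
    (tau pu gu uu vu qu gphi pv vv vq c : K)
    (P P' G G' Q Q' W W' F F' V V' C C' : K) :
  tau != 0 ->
  pu + gu + uu + vu + qu = 0 ->
  pu = 2^-1 * ((P - P') / tau) -> gu = 2^-1 * ((G - G') / tau) ->
  uu = 2^-1 * ((Q - Q') / tau) -> qu = 2^-1 * (2^-1 * ((W - W') / tau)) ->
  gphi = - pv -> gphi = 2^-1 * ((F - F') / tau) ->
  pv - vv - vq = 0 -> vv = 2^-1 * ((V - V') / tau) ->
  vu = 2^-1 * c -> c + vq = (C - C') / tau ->
  G + Q + P + 2^-1 * V + 2^-1 * F + 2^-1 * W + C
  = G' + Q' + P' + 2^-1 * V' + 2^-1 * F' + 2^-1 * W' + C'.
Proof.
move=> tau0 *; apply/eqP; rewrite -subr_eq0; apply/eqP.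
by apply: (mulIf (invr_neq0 tau0)); rewrite mul0r; lra.
Qed.

Section conservation.
Context {R : realType} {d : nat}.
Variables (Omega : set 'rV[R]_d) (Th : uniform_mesh R d).
Hypothesis Omega_open : open Omega.
Hypothesis Omega_mesh : mesh_of Omega Th.
Implicit Types (tau : R) (n : nat) (u p : nat -> 'rV[R]_d -> R[i])
  (f phi vphi : nat -> 'rV[R]_d -> R).

Lemma tavg_lincomb f n : tavg f n = fun x => 2^-1 * f n x + 2^-1 * f n.-1 x.
Proof. by apply/funext => x; rewrite /tavg mulrC mulrDr. Qed.

Lemma bdiff_lincomb tau f n :
  bdiff tau f n = fun x => tau^-1 * f n x + - tau^-1 * f n.-1 x.
Proof. by apply/funext => x; rewrite /bdiff mulNr -mulrBr mulrC. Qed.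

Lemma V0_bdiff tau f n : V0 Omega Th (f n) -> V0 Omega Th (f n.-1) ->
  V0 Omega Th (bdiff tau f n).
Proof. by rewrite bdiff_lincomb; exact: V0_lincomb. Qed.

Lemma partial_tavg f n i : V0 Omega Th (f n) -> V0 Omega Th (f n.-1) ->
  partial Th (tavg f n) i = tavg (fun k => partial Th (f k) i) n.
Proof. by move=> fn fm; rewrite !tavg_lincomb (partial_lincomb _ _ _ fn fm). Qed.

Lemma partial_bdiff tau f n i : V0 Omega Th (f n) -> V0 Omega Th (f n.-1) ->
  partial Th (bdiff tau f n) i = bdiff tau (fun k => partial Th (f k) i) n.
Proof. by move=> fn fm; rewrite !bdiff_lincomb (partial_lincomb _ _ _ fn fm). Qed.

Lemma V0C_Re (v : 'rV[R]_d -> R[i]) : V0C Omega Th v ->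
  V0 Omega Th (fun x => complex.Re (v x)).
Proof. by move=> [a [b [Va _ ->]]]. Qed.

Lemma V0C_Im (v : 'rV[R]_d -> R[i]) : V0C Omega Th v ->
  V0 Omega Th (fun x => complex.Im (v x)).
Proof. by move=> [a [b [_ Vb ->]]]. Qed.

Lemma V0C_bdiff tau u n : V0C Omega Th (u n) -> V0C Omega Th (u n.-1) ->
  V0C Omega Th (bdiff tau%:C u n).
Proof.
move=> un um.
exists (bdiff tau (fun k y => complex.Re (u k y)) n).
exists (bdiff tau (fun k y => complex.Im (u k y)) n); split.
- by apply: V0_bdiff; exact: V0C_Re.
- by apply: V0_bdiff; exact: V0C_Im.
- by apply/funext => x; exact: bdiffC.
Qed.

Lemma partialC_tavg u n i x : V0C Omega Th (u n) -> V0C Omega Th (u n.-1) ->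
  partialC Th (tavg u n) i x = tavg (fun k => partialC Th (u k) i) n x.
Proof.
move=> un um; rewrite /partialC tavgC.
under eq_fun do rewrite tavgC; under [in X in _ +i* X]eq_fun do rewrite tavgC.
by rewrite /= !partial_tavg//; (exact: V0C_Re || exact: V0C_Im).
Qed.

Lemma partialC_bdiff tau u n i x : V0C Omega Th (u n) -> V0C Omega Th (u n.-1) ->
  partialC Th (bdiff tau%:C u n) i x
  = bdiff tau%:C (fun k => partialC Th (u k) i) n x.
Proof.
move=> un um; rewrite /partialC bdiffC.
under eq_fun do rewrite bdiffC; under [in X in _ +i* X]eq_fun do rewrite bdiffC.
by rewrite /= !partial_bdiff//; (exact: V0C_Re || exact: V0C_Im).
Qed.

Lemma bdmeas_modulus_sqr (v : 'rV[R]_d -> R[i]) : V0C Omega Th v ->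
  bdmeas Omega (fun x => modulus (v x) ^+ 2).
Proof.
move=> Vv; under eq_fun do rewrite modulus_sqr.
by apply: bdmeasD; apply: bdmeasX; apply: (bdmeas_V0 Omega_mesh);
  (exact: V0C_Re || exact: V0C_Im).
Qed.

Lemma bdmeas_grad_modulus_sqr (v : 'rV[R]_d -> R[i]) : V0C Omega Th v ->
  bdmeas Omega (fun x => \sum_i modulus (partialC Th v i x) ^+ 2).
Proof.
move=> Vv; apply: bdmeas_sum => i; under eq_fun do rewrite modulus_sqr /=.
by apply: bdmeasD; apply: bdmeasX; apply: bdmeas_partial;
  (exact: V0C_Re || exact: V0C_Im).
Qed.

Lemma bdmeas_grad_sqr (v : 'rV[R]_d -> R) : V0 Omega Th v ->
  bdmeas Omega (fun x => \sum_i partial Th v i x ^+ 2).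
Proof.
move=> Vv; apply: bdmeas_sum => i; apply: bdmeasX.
exact: bdmeas_partial.
Qed.

Local Notation I f := (Rintegral (lebesgue_rV d) Omega f).

Lemma integrable_domain (g : 'rV[R]_d -> R) : bdmeas Omega g ->
  (lebesgue_rV d).-integrable Omega (EFin \o g).
Proof.
apply: bdmeas_integrable; first exact: open_measurable_rV.
exact: (domain_lty Omega_open Omega_mesh).
Qed.

Lemma Rintegral_bdiff tau f n : bdmeas Omega (f n) -> bdmeas Omega (f n.-1) ->
  I (bdiff tau f n) = (I (f n) - I (f n.-1)) / tau.
Proof.
move=> fn fm; have mO := open_measurable_rV Omega_open.
rewrite RintegralZr//; last by apply: integrable_domain; exact: bdmeasB.
by rewrite RintegralB//; exact: integrable_domain.
Qed.

Lemma bdmeas_bdiff tau f n : bdmeas Omega (f n) -> bdmeas Omega (f n.-1) ->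
  bdmeas Omega (bdiff tau f n).
Proof. by move=> fn fm; apply: bdmeasM; [exact: bdmeasB | exact: bdmeas_cst]. Qed.

Lemma Rintegral_domainZ (c : R) (g : 'rV[R]_d -> R) : bdmeas Omega g ->
  I (fun x => c * g x) = c * I g.
Proof.
move=> bg; rewrite RintegralZl//; last exact: integrable_domain.
exact: open_measurable_rV.
Qed.

Lemma Rintegral_domainD (g h : 'rV[R]_d -> R) :
  bdmeas Omega g -> bdmeas Omega h -> I (fun x => g x + h x) = I g + I h.
Proof.
move=> bg bh; rewrite RintegralD//; try exact: integrable_domain.
exact: open_measurable_rV.
Qed.

Lemma bdmeas_tavg f n : bdmeas Omega (f n) -> bdmeas Omega (f n.-1) ->
  bdmeas Omega (tavg f n).
Proof. by move=> fn fm; apply: bdmeasM; [exact: bdmeasD | exact: bdmeas_cst]. Qed.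

Lemma normL_sqr (v : 'rV[R]_d -> R) :
  normL Omega 2 v ^+ 2 = I (fun x => v x ^+ 2).
Proof.
rewrite [LHS](@Lp_norm_exp _ _ Omega 2)//.
by apply: eq_Rintegral => x _; rewrite normr_id real_normK ?num_real.
Qed.

Lemma normLC_sqr (v : 'rV[R]_d -> R[i]) :
  normLC Omega 2 v ^+ 2 = I (fun x => modulus (v x) ^+ 2).
Proof.
rewrite [LHS](@Lp_norm_exp _ _ Omega 2)//.
by apply: eq_Rintegral => x _; rewrite real_normK ?num_real.
Qed.

Lemma normLC_exp4 (v : 'rV[R]_d -> R[i]) :
  normLC Omega 4 v ^+ 4 = I (fun x => (modulus (v x) ^+ 2) ^+ 2).
Proof.
rewrite [LHS](@Lp_norm_exp _ _ Omega 4)//.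
apply: eq_Rintegral => x _.
by rewrite [LHS](exprM _ 2 2) real_normK ?num_real.
Qed.

Lemma normL_grad_sqr (v : 'rV[R]_d -> R) :
  normL_grad Omega Th 2 v ^+ 2 = I (fun x => \sum_i partial Th v i x ^+ 2).
Proof.
rewrite [LHS](@Lp_norm_exp _ _ Omega 2)//.
apply: eq_Rintegral => x _; rewrite real_normK ?num_real//.
by rewrite sqr_sqrtr// sumr_ge0// => i _; exact: sqr_ge0.
Qed.

Lemma normLC_grad_sqr (v : 'rV[R]_d -> R[i]) :
  normLC_grad Omega Th 2 v ^+ 2
  = I (fun x => \sum_i modulus (partialC Th v i x) ^+ 2).
Proof.
rewrite [LHS](@Lp_norm_exp _ _ Omega 2)//.
apply: eq_Rintegral => x _; rewrite real_normK ?num_real//.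
by rewrite sqr_sqrtr// sumr_ge0// => i _; exact: sqr_ge0.
Qed.

Lemma energyE (u p : 'rV[R]_d -> R[i]) (phi vphi : 'rV[R]_d -> R) :
  energy Omega Th u p phi vphi =
  I (fun x => \sum_i modulus (partialC Th u i x) ^+ 2)
  + I (fun x => modulus (u x) ^+ 2) + I (fun x => modulus (p x) ^+ 2)
  + 2^-1 * I (fun x => vphi x ^+ 2)
  + 2^-1 * I (fun x => \sum_i partial Th phi i x ^+ 2)
  + 2^-1 * I (fun x => (modulus (u x) ^+ 2) ^+ 2)
  + I (fun x => vphi x * modulus (u x) ^+ 2).
Proof.
by rewrite /energy (normLC_grad_sqr u) (normLC_sqr u) (normLC_sqr p)
  (normL_sqr vphi) (normL_grad_sqr phi) (normLC_exp4 u).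
Qed.

Lemma Re_ipC_grad_tavg_bdiff tau u n :
  V0C Omega Th (u n) -> V0C Omega Th (u n.-1) ->
  complex.Re (ipC_grad Omega Th (tavg u n) (bdiff tau%:C u n))
  = 2^-1 * ((I (fun x => \sum_i modulus (partialC Th (u n) i x) ^+ 2)
            - I (fun x => \sum_i modulus (partialC Th (u n.-1) i x) ^+ 2)) / tau).
Proof.
move=> un um; pose G k x := \sum_i modulus (partialC Th (u k) i x) ^+ 2.
have bGn := bdmeas_grad_modulus_sqr un.
have bGm := bdmeas_grad_modulus_sqr um.
rewrite -(@Rintegral_bdiff tau G n bGn bGm).
rewrite -Rintegral_domainZ; last exact: bdmeas_bdiff.
apply: eq_Rintegral => x _.
rewrite (raddf_sum (@complex.Re R : Rcomplex R -> R)).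
rewrite /bdiff /G -sumrB mulr_suml mulr_sumr; apply: eq_bigr => i _.
by rewrite partialC_tavg// partialC_bdiff//; exact: Re_tavg_bdiff.
Qed.

Lemma ip_grad_tavg_bdiff tau f n :
  V0 Omega Th (f n) -> V0 Omega Th (f n.-1) ->
  ip_grad Omega Th (tavg f n) (bdiff tau f n)
  = 2^-1 * ((I (fun x => \sum_i partial Th (f n) i x ^+ 2)
            - I (fun x => \sum_i partial Th (f n.-1) i x ^+ 2)) / tau).
Proof.
move=> fn fm; pose G k x := \sum_i partial Th (f k) i x ^+ 2.
have bGn := bdmeas_grad_sqr fn.
have bGm := bdmeas_grad_sqr fm.
rewrite -(@Rintegral_bdiff tau G n bGn bGm).
rewrite -Rintegral_domainZ; last exact: bdmeas_bdiff.
apply: eq_Rintegral => x _.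
rewrite /bdiff /G -sumrB mulr_suml mulr_sumr; apply: eq_bigr => i _.
rewrite partial_tavg// partial_bdiff// /tavg /bdiff.
by set t := tau^-1; field.
Qed.

Lemma Rintegral_tavg_bdiffM tau f g n :
  bdmeas Omega (f n) -> bdmeas Omega (f n.-1) ->
  bdmeas Omega (g n) -> bdmeas Omega (g n.-1) ->
  I (fun x => tavg f n x * bdiff tau g n x)
  + I (fun x => tavg g n x * bdiff tau f n x)
  = (I (fun x => f n x * g n x) - I (fun x => f n.-1 x * g n.-1 x)) / tau.
Proof.
move=> fn fm gn gm.
rewrite -(@Rintegral_bdiff tau (fun k x => f k x * g k x)); try exact: bdmeasM.
rewrite -Rintegral_domainD; try by apply: bdmeasM;
  (exact: bdmeas_tavg || exact: bdmeas_bdiff).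
by apply: eq_Rintegral => x _; rewrite [X in _ + X]mulrC; exact: tavg_bdiffM.
Qed.

Lemma Rintegral_tavg_bdiff tau f n :
  bdmeas Omega (f n) -> bdmeas Omega (f n.-1) ->
  I (fun x => tavg f n x * bdiff tau f n x)
  = 2^-1 * ((I (fun x => f n x ^+ 2) - I (fun x => f n.-1 x ^+ 2)) / tau).
Proof.
move=> fn fm.
rewrite -(@Rintegral_bdiff tau (fun k x => f k x ^+ 2)); try exact: bdmeasX.
rewrite -Rintegral_domainZ; last by apply: bdmeas_bdiff; exact: bdmeasX.
apply: eq_Rintegral => x _; rewrite /tavg /bdiff.
by set t := tau^-1; field.
Qed.

Lemma Re_ipC_tavg_bdiff tau u n :
  V0C Omega Th (u n) -> V0C Omega Th (u n.-1) ->
  complex.Re (ipC Omega (tavg u n) (bdiff tau%:C u n))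
  = 2^-1 * ((I (fun x => modulus (u n x) ^+ 2)
             - I (fun x => modulus (u n.-1 x) ^+ 2)) / tau).
Proof.
move=> un um; have bun := bdmeas_modulus_sqr un.
have bum := bdmeas_modulus_sqr um.
rewrite -(@Rintegral_bdiff tau (fun k x => modulus (u k x) ^+ 2) n bun bum).
rewrite -Rintegral_domainZ; last exact: bdmeas_bdiff.
by apply: eq_Rintegral => x _; exact: Re_tavg_bdiff.
Qed.

(** For a real weight [w], here the averaged potential or the averaged density
    |u|^2, only the difference quotient of |u|^2 survives in the real part. *)
Lemma Re_ipC_weighted_tavg_bdiff tau (w : 'rV[R]_d -> R) u n :
  complex.Re (ipC Omega (fun x => (w x)%:C * tavg u n x) (bdiff tau%:C u n))
  = I (fun x => 2^-1 * (w x * bdiff tau (fun k y => modulus (u k y) ^+ 2) n x)).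
Proof.
apply: eq_Rintegral => x _.
by rewrite -mulrA ReMc Re_tavg_bdiff mulrCA.
Qed.

(** The four test functions are the difference quotients of p, u, phi and vphi.
    The Leibniz rule turns every term into a difference of energy terms, apart
    from the products of two difference quotients, (p, u) and (vphi, phi): each
    occurs in two of the equations and is eliminated between them. The two
    halves of the difference of (vphi, |u|^2) come from different equations,
    the second and the fourth, and are added in [cross]. *)
Lemma energy_step tau u p phi vphi n :
  tau != 0 ->
  V0C Omega Th (u n) -> V0C Omega Th (u n.-1) ->
  V0C Omega Th (p n) -> V0C Omega Th (p n.-1) ->
  V0 Omega Th (phi n) -> V0 Omega Th (phi n.-1) ->
  V0 Omega Th (vphi n) -> V0 Omega Th (vphi n.-1) ->
  ipC Omega (tavg p n) (bdiff tau%:C p n)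
    = ipC Omega (bdiff tau%:C u n) (bdiff tau%:C p n) ->
  ipC Omega (bdiff tau%:C p n) (bdiff tau%:C u n)
  + ipC_grad Omega Th (tavg u n) (bdiff tau%:C u n)
  + ipC Omega (tavg u n) (bdiff tau%:C u n)
  + ipC Omega (fun x => (tavg vphi n x)%:C * tavg u n x) (bdiff tau%:C u n)
  + ipC Omega
      (fun x => (2^-1 * (modulus (u n x) ^+ 2 + modulus (u n.-1 x) ^+ 2))%:C
                * tavg u n x) (bdiff tau%:C u n) = 0 ->
  ip_grad Omega Th (tavg phi n) (bdiff tau phi n)
    = - ip Omega (bdiff tau vphi n) (bdiff tau phi n) ->
  ip Omega (bdiff tau phi n) (bdiff tau vphi n)
  - ip Omega (tavg vphi n) (bdiff tau vphi n)
  - ip Omega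
      (fun x => 2^-1 * (modulus (u n x) ^+ 2 + modulus (u n.-1 x) ^+ 2))
      (bdiff tau vphi n) = 0 ->
  energy Omega Th (u n) (p n) (phi n) (vphi n)
  = energy Omega Th (u n.-1) (p n.-1) (phi n.-1) (vphi n.-1).
Proof.
move=> tau0 un um pn pm phn phm vn vm S1 S2 S3 S4.
pose q k x := modulus (u k x) ^+ 2.
have bqn : bdmeas Omega (q n) := bdmeas_modulus_sqr un.
have bqm : bdmeas Omega (q n.-1) := bdmeas_modulus_sqr um.
have bvn := bdmeas_V0 Omega_mesh vn; have bvm := bdmeas_V0 Omega_mesh vm.
have qavg x : 2^-1 * (modulus (u n x) ^+ 2 + modulus (u n.-1 x) ^+ 2)
    = tavg q n x by rewrite /tavg mulrC.
have sym : complex.Re (ipC Omega (bdiff tau%:C p n) (bdiff tau%:C u n))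
    = complex.Re (ipC Omega (bdiff tau%:C u n) (bdiff tau%:C p n)).
  by apply: eq_Rintegral => x _; rewrite !Re_MconjC; congr (_ + _); exact: mulrC.
have eq_pu := etrans sym (etrans (esym (congr1 (@complex.Re R) S1))
  (Re_ipC_tavg_bdiff tau pn pm)).
have weighted (w : 'rV[R]_d -> R) (bw : bdmeas Omega w) :=
  etrans (Re_ipC_weighted_tavg_bdiff tau w u n)
    (Rintegral_domainZ 2^-1 (bdmeasM bw (bdmeas_bdiff tau bqn bqm))).
have eq_vphi := weighted _ (bdmeas_tavg bvn bvm).
have := weighted _ (bdmeas_tavg bqn bqm).
rewrite (Rintegral_tavg_bdiff tau bqn bqm) -(funext qavg) => eq_q.
have := congr1 (@complex.Re R) S2; rewrite !ReD => {}S2.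
have eq_vv := Rintegral_tavg_bdiff tau bvn bvm.
have cross := Rintegral_tavg_bdiffM tau bvn bvm bqn bqm.
have eq_phiv : ip Omega (bdiff tau vphi n) (bdiff tau phi n)
    = ip Omega (bdiff tau phi n) (bdiff tau vphi n).
  by apply: eq_Rintegral => x _; rewrite mulrC.
rewrite (funext qavg) in S4.
rewrite !energyE.
exact: (combine_tested_equations tau0 S2 eq_pu
  (Re_ipC_grad_tavg_bdiff tau un um) (Re_ipC_tavg_bdiff tau un um) eq_q
  (etrans S3 (congr1 -%R eq_phiv)) (ip_grad_tavg_bdiff tau phn phm) S4 eq_vv
  eq_vphi cross).
Qed.

End conservation.

Theorem theorem2p1 (R : realType) (d : nat) (d23 : d = 2%N \/ d = 3%N)
  (Omega : set 'rV[R]_d) (Omega_neq0 : Omega !=set0) (Omega_open : open Omega)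
  (Omega_bounded : bounded_set Omega) (Omega_convex : convex_set Omega)
  (Th : uniform_mesh R d) (Omega_mesh : mesh_of Omega Th)
  (T : R) (T_gt0 : 0 < T) (N : nat) (N_gt0 : (0 < N)%N)
  (tau : R) (tauE : tau = T / N%:R)
  (u p : nat -> 'rV[R]_d -> R[i]) (phi vphi : nat -> 'rV[R]_d -> R)
  (u_V0 : forall n, (n <= N)%N -> V0C Omega Th (u n))
  (p_V0 : forall n, (n <= N)%N -> V0C Omega Th (p n))
  (phi_V0 : forall n, (n <= N)%N -> V0 Omega Th (phi n))
  (vphi_V0 : forall n, (n <= N)%N -> V0 Omega Th (vphi n))
  (scheme1 : forall n, (1 <= n <= N)%N -> forall v1, V0C Omega Th v1 ->
     ipC Omega (tavg p n) v1 = ipC Omega (bdiff tau%:C u n) v1)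
  (scheme2 : forall n, (1 <= n <= N)%N -> forall v2, V0C Omega Th v2 ->
     ipC Omega (bdiff tau%:C p n) v2
     + ipC_grad Omega Th (tavg u n) v2
     + ipC Omega (tavg u n) v2
     + ipC Omega (fun x => (tavg vphi n x)%:C * tavg u n x) v2
     + ipC Omega
         (fun x => (2^-1 * (modulus (u n x) ^+ 2 + modulus (u n.-1 x) ^+ 2))%:C
                   * tavg u n x) v2
     = 0)
  (scheme3 : forall n, (1 <= n <= N)%N -> forall w1, V0 Omega Th w1 ->
     ip_grad Omega Th (tavg phi n) w1 = - ip Omega (bdiff tau vphi n) w1)
  (scheme4 : forall n, (1 <= n <= N)%N -> forall w2, V0 Omega Th w2 ->
     ip Omega (bdiff tau phi n) w2
     - ip Omega (tavg vphi n) w2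
     - ip Omega
         (fun x => 2^-1 * (modulus (u n x) ^+ 2 + modulus (u n.-1 x) ^+ 2)) w2
     = 0) :
  forall m n, (m <= N)%N -> (n <= N)%N ->
    energy Omega Th (u m) (p m) (phi m) (vphi m)
    = energy Omega Th (u n) (p n) (phi n) (vphi n).
Proof.
have tau0 : tau != 0.
  by rewrite tauE mulf_neq0 ?invr_eq0 ?pnatr_eq0 -?lt0n// gt_eqF.
suff E n : (n <= N)%N -> energy Omega Th (u n) (p n) (phi n) (vphi n)
    = energy Omega Th (u 0%N) (p 0%N) (phi 0%N) (vphi 0%N).
  by move=> m n mN nN; rewrite !E.
elim: n => // n IH nN; rewrite -(IH (ltnW nN)).
have [un um] := (u_V0 _ nN, u_V0 _ (ltnW nN)).
have [pn pm] := (p_V0 _ nN, p_V0 _ (ltnW nN)).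
have [phn phm] := (phi_V0 _ nN, phi_V0 _ (ltnW nN)).
have [vn vm] := (vphi_V0 _ nN, vphi_V0 _ (ltnW nN)).
apply: (energy_step Omega_open Omega_mesh tau0 un um pn pm phn phm vn vm).
- by apply: scheme1 => //; exact: V0C_bdiff.
- by apply: scheme2 => //; exact: V0C_bdiff.
- by apply: scheme3 => //; exact: V0_bdiff.
- by apply: scheme4 => //; exact: V0_bdiff.
Qed.
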